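(* Let $X$ be a Polish space and let $F$ be a face of $P(X)$ with the Baire property. Then $F$ is either a meager or a co-meager subset of $P(X)$.
   Context: $P(X)$ denotes the space of all Borel probability measures on $X$, equipped with the weak topology (convergence against bounded continuous real functions), which makes it a Polish space. A subset $F\subseteq P(X)$ is a face of $P(X)$ if it is an extreme convex subset of $P(X)$: $F$ is convex, and whenever $\mu,\nu\in P(X)$ and $t\in(0,1)$ satisfy $t\mu+(1-t)\nu\in F$, then $\mu\in F$ and $\nu\in F$. *)

(* Defs.v *)
From HB Require Import structures.
From mathcomp Require Import all_boot all_order all_algebra.
From mathcomp Require Import all_classical all_reals all_analysis.

Set Implicit Arguments.
Unset Strict Implicit.
Unset Printing Implicit Defensive.

Import Order.TTheory GRing.Theory Num.Theory.
Import numFieldNormedType.Exports.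

Local Open Scope classical_set_scope.
Local Open Scope ring_scope.

Section polish.
Context (R : realType) (X : topologicalType).

Definition separable := exists2 D : set X, countable D & dense D.

Definition completely_metrizable :=
  exists (M : metricType R) (f : X -> M) (g : M -> X),
    [/\ cancel f g, cancel g f, continuous f, continuous g
      & forall F : set_system M, ProperFilter F -> cauchy F ->
          exists l : M, F --> l].

Definition polish := separable /\ completely_metrizable.

End polish.
Arguments separable : clear implicits.
Arguments completely_metrizable : clear implicits.
Arguments polish : clear implicits.

Section category.
Context {T : topologicalType}.
Implicit Types A U : set T.

Definition nowhere_dense A := (closure A)° = set0.

Definition meager A :=
  exists2 N : (set T)^nat, (forall n, nowhere_dense (N n)) & A `<=` \bigcup_n N n.

Definition comeager A := meager (~` A).

Definition baire_property A := exists2 U, open U & meager (A `+` U).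

End category.

Section face.
Context {R : realType} {T : convType R}.
Local Open Scope convex_scope.

Definition face (F : set T) :=
  (forall (x y : T) (t : {i01 R}), F x -> F y -> F (x <| t |> y)) /\
  (forall (x y : T) (t : {i01 R}), 0 < t%:num < 1 ->
     F (x <| t |> y) -> F x /\ F y).

End face.

(* Measurable types of the library are pointed, hence X is nonempty; for the
   empty space there is no Borel probability measure at all. *)
Definition borel (X : ptopologicalType) := g_sigma_algebraType (@open X).
HB.instance Definition _ (X : ptopologicalType) := Measurable.on (borel X).

(* A [probability] is a function on all subsets, unconstrained outside the
   sigma-algebra; pinning it to 0 there makes the elements of [borel_prob]
   correspond exactly to the Borel probability measures. *)
Record borel_prob (X : ptopologicalType) (R : realType) := BorelProb {
  borel_prob_val :> probability (borel X) R ;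
  borel_prob_out : forall A : set (borel X),
    ~ measurable A -> borel_prob_val A = 0%E }.

HB.instance Definition _ X R := gen_eqMixin (borel_prob X R).
HB.instance Definition _ X R := gen_choiceMixin (borel_prob X R).

Section borel_prob_ext.
Context {X : ptopologicalType} {R : realType}.

Lemma borel_prob_ext (mu nu : borel_prob X R) :
  (forall A : set (borel X), measurable A -> mu A = nu A) -> mu = nu.
Proof.
move=> mn; have E : borel_prob_val mu = borel_prob_val nu.
  have : borel_prob_val mu = borel_prob_val nu :> (set (borel X) -> \bar R).
    apply/funext => A; have [/mn//|mA] := pselect (measurable A).
    by rewrite !borel_prob_out.
  case: (borel_prob_val mu) (borel_prob_val nu) => [m mc] [n nc] /= mnE.
  subst n.
  case: mc nc => [[a1 a2] [b] [c] [d] [e] [f] [g]].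
  case=> [[a1' a2'] [b'] [c'] [d'] [e'] [f'] [g']].
  have Ea1 : a1 = a1' by exact: Prop_irrelevance.
  have Ea2 : a2 = a2' by exact: Prop_irrelevance.
  subst a1' a2'; do ! [f_equal; try exact: Prop_irrelevance].
case: mu nu E {mn} => mu mu0 [nu nu0] /= E; subst nu.
by congr BorelProb; exact: Prop_irrelevance.
Qed.

End borel_prob_ext.

Lemma borel_prob_of (X : ptopologicalType) (R : realType)
    (P : probability (borel X) R) :
  exists mu : borel_prob X R, forall A, measurable A -> mu A = P A.
Proof.
pose m (A : set (borel X)) : \bar R := if `[< measurable A >] then P A else 0%E.
have mE A : measurable A -> m A = P A by move=> mA; rewrite /m asboolT.
have m0 : m set0 = 0%E by rewrite mE ?measure0.
have m_ge0 A : (0 <= m A)%E by rewrite /m; case: ifP.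
have m_add : semi_sigma_additive m.
  move=> F mF tF mUF; rewrite mE//.
  rewrite (_ : (fun n => _) = (fun n => \sum_(0 <= i < n) P (F i))%E).
    exact: measure_semi_sigma_additive.
  by apply/funext => n; apply: eq_bigr => i _; rewrite mE.
have m1 : m setT = 1%E by rewrite mE ?probability_setT.
pose mM := isMeasure.Build _ _ _ m m0 m_ge0 m_add.
pose mu : {measure set (borel X) -> \bar R} := HB.pack m mM.
pose mP := Measure_isProbability.Build _ _ _ mu m1.
pose Pm : probability (borel X) R := HB.pack m mM mP.
have out A : ~ measurable A -> Pm A = 0%E by move=> mA; rewrite /= /m asboolF.
by exists (BorelProb out) => A mA; exact: mE.
Qed.

Section mixture.
Context {X : ptopologicalType} {R : realType}.
Implicit Types (t : {i01 R}) (mu nu : borel_prob X R).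

Definition mixture t mu nu (A : set (borel X)) : \bar R :=
  (t%:num%:E * mu A + (1 - t%:num)%:E * nu A)%E.

Section measure.
Local Open Scope ereal_scope.
Variables (t : {i01 R}) (mu nu : borel_prob X R).

Let t_ge0 : (0 <= t%:num)%R. Proof. by []. Qed.

Let onem_ge0 : (0 <= 1 - t%:num)%R. Proof. by rewrite subr_ge0. Qed.

Let mixtureE : mixture t mu nu =
  measure_add (mscale (NngNum t_ge0) mu) (mscale (NngNum onem_ge0) nu).
Proof. by apply/funext => A; rewrite measure_addE. Qed.

Let mixture0 : mixture t mu nu set0 = 0.
Proof. by rewrite /mixture !measure0 !mule0 adde0. Qed.

Let mixture_ge0 A : 0 <= mixture t mu nu A.
Proof. by rewrite /mixture adde_ge0// mule_ge0// lee_fin. Qed.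

Let mixture_sigma_additive : semi_sigma_additive (mixture t mu nu).
Proof. by rewrite mixtureE; exact: measure_semi_sigma_additive. Qed.

HB.instance Definition _ := isMeasure.Build _ _ _ (mixture t mu nu)
  mixture0 mixture_ge0 mixture_sigma_additive.

Let mixture_setT : mixture t mu nu setT = 1.
Proof.
by rewrite /mixture !probability_setT !mule1 -EFinD addrC subrK.
Qed.

HB.instance Definition _ := Measure_isProbability.Build _ _ _
  (mixture t mu nu) mixture_setT.

Lemma mixture_out A : ~ measurable A -> mixture t mu nu A = 0.
Proof. by move=> mA; rewrite /mixture !borel_prob_out// !mule0 adde0. Qed.

Definition mix : borel_prob X R := BorelProb mixture_out.

End measure.

Lemma fine_mix t mu nu (A : set (borel X)) : measurable A ->
  mix t mu nu A = (t%:num * fine (mu A) + (1 - t%:num) * fine (nu A))%:E.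
Proof.
move=> mA; rewrite EFinD !EFinM !fineK//; exact: fin_num_measure.
Qed.

Let mix1 mu nu : mix 1%:i01 mu nu = mu.
Proof.
apply: borel_prob_ext => A mA; rewrite fine_mix//= subrr mul0r addr0 mul1r.
by rewrite fineK//; exact: fin_num_measure.
Qed.

Let mixmm t mu : mix t mu mu = mu.
Proof.
apply: borel_prob_ext => A mA; rewrite fine_mix// -mulrDl addrC subrK mul1r.
by rewrite fineK//; exact: fin_num_measure.
Qed.

Let mixC t mu nu : mix t mu nu = mix (1 - t%:inum)%:i01 nu mu.
Proof.
by apply: borel_prob_ext => A mA; rewrite !fine_mix//= subKr addrC.
Qed.

Let mixA : convex_quasi_associative mix.
Proof.
move=> p q r s a b c prs spq; apply: borel_prob_ext => A mA.
rewrite !fine_mix//=; congr EFin.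
have e := ConvexQuasiAssoc.pq_sr prs spq.
have {}spq : 1 - s%:num = (1 - p%:num) * (1 - q%:num) by [].
by rewrite !mulrDr !mulrA addrA e -spq prs [s%:num * r%:num]mulrC.
Qed.

HB.instance Definition _ :=
  isConvexSpace.Build R (borel_prob X R) mix1 mixmm mixC mixA.

End mixture.

Section weak_topology.
Context (X : ptopologicalType) (R : realType).

Definition bounded_continuous :=
  {f : X -> R | continuous f /\ bounded_fun f}.

Definition integrals (mu : borel_prob X R) : {ptws bounded_continuous -> R} :=
  fun f => \int[mu]_x (sval f x).

HB.instance Definition _ :=
  Topological.copy (borel_prob X R) (initial_topology integrals).

Lemma weak_cvgP (F : set_system (borel_prob X R)) (mu : borel_prob X R) :
  Filter F ->
  F --> mu <->
  forall f : X -> R, continuous f -> bounded_fun f ->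
    (fun nu : borel_prob X R => \int[nu]_x (f x : R)) @ F -->
    (\int[mu]_x (f x : R) : R).
Proof.
move=> FF; split=> [Fmu f cf bf|Fmu].
  have Fi : integrals @ F --> integrals mu.
    exact: cvg_trans (cvg_app integrals Fmu)
      (@initial_continuous _ _ integrals mu).
  have /cvg_sup/(_ (exist _ f (conj cf bf))) Ff := Fi.
  exact: cvg_trans (cvg_app _ Ff) (@initial_continuous _ _ _ (integrals mu)).
move=> A; rewrite nbhsE /= => -[B [[C oC <-] Cmu] /filterS]; apply.
suff : integrals @ F --> integrals mu by apply; exact: open_nbhs_nbhs.
apply/cvg_sup => -[f [cf bf]].
move=> B'; rewrite nbhsE /= => -[_ [[D oD <-] Dmu] /filterS]; apply.
by apply: (Fmu f cf bf); exact: open_nbhs_nbhs.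
Qed.

End weak_topology.

(* Main.v *)
Require Import Defs.
From HB Require Import structures.
From mathcomp Require Import all_boot all_order all_algebra.
From mathcomp Require Import all_classical all_reals all_analysis.
From mathcomp Require Import measurable_realfun.
From mathcomp Require Import ring lra.

Set Implicit Arguments.
Unset Strict Implicit.
Unset Printing Implicit Defensive.

Import Order.TTheory GRing.Theory Num.Theory.
Import numFieldNormedType.Exports.

Local Open Scope classical_set_scope.
Local Open Scope ring_scope.

(** Write the mixture [t mu + (1 - t) nu] as [mix t mu nu]. Let [F] agree with
    an open set [U] up to a meager set. If [U] is meager, so is [F]. Otherwise
    [U] minus [F] is covered by nowhere dense sets [N n], and it suffices to
    find one [nu] in [U] such that, for all [n] and all [t] in a sequence of
    weights in the open unit interval tending to 0, the set of [mu] with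
    [mix t mu nu] in [N n] is nowhere dense. Indeed, for every [mu] the mixtures
    [mix t mu nu] tend to [nu] and hence enter [U]; if [mu] is not in [F], then,
    [F] being a face, neither is the mixture, so that the mixture lies in some
    [N n]. The complement of [F] is thus covered by countably many nowhere
    dense sets.

    As [U] is not meager, such a [nu] exists as soon as, for each [n] and [t],
    all [nu] outside a meager set have the required property. This is a
    Kuratowski-Ulam argument, [generic_section]. It uses that the space of
    probability measures is second countable, [second_countable_borel_prob] and
    [exists_bumps], that the mixture is continuous, [mix_cvg], and that it is an
    open map of the pair of measures, [mix_open].

    For openness, let [lam] be the mixture of [mu] and [nu]. Then [t mu] has a
    density with respect to [lam], with values between 0 and 1. A weak
    neighbourhood involves finitely many test functions, so this density may be
    replaced by a continuous function [g] with nearly the same integrals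
    against them, built from a partition of unity on the pieces of which the
    test functions are almost constant, [partition_of_unity] and [exists_cut]. A
    measure close to [lam] is cut by [g] and [1 - g] into two pieces close to
    [t mu] and [(1 - t) nu]. *)

(** * Meager sets *)

Section category.
Context {T : topologicalType}.
Implicit Types A B N : set T.

Lemma nowhere_denseP N : nowhere_dense N <->
  forall O, open O -> O !=set0 -> exists2 x, O x & ~ closure N x.
Proof.
split=> [N0 O oO [x Ox]|h].
  apply: contrapT => nox.
  suff : (closure N)° x by rewrite N0.
  rewrite /interior nbhsE; exists O; first by split.
  by move=> y Oy; apply: contrapT => Ny; apply: nox; exists y.
rewrite /nowhere_dense -subset0 => x Nx.
have [|y Ny] := h _ (open_interior (closure N)); first by exists x.
by apply; exact: interior_subset.
Qed.

Lemma meager_sub A B : A `<=` B -> meager B -> meager A.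
Proof. by move=> AB [N nN BN]; exists N => //; exact: subset_trans BN. Qed.

(** Indices of any countable type are allowed so that unions over pairs and
    tagged sums of indices need no explicit enumeration. *)
Lemma meager_bigcup (I : countType) (N : I -> set T) :
  (forall i, nowhere_dense (N i)) -> meager (\bigcup_i N i).
Proof.
move=> nN.
exists (fun n => if unpickle n is Some i then N i else set0).
  move=> n; case: unpickle => [i//|].
  by rewrite /nowhere_dense closure0 interior0.
by move=> x [i _ Nx]; exists (pickle i) => //; rewrite pickleK.
Qed.

Lemma meagerU A B : meager A -> meager B -> meager (A `|` B).
Proof.
move=> [N nN AN] [N' nN' BN'].
pose NN (u : bool * nat) := if u.1 then N u.2 else N' u.2.
apply: (@meager_sub _ (\bigcup_u NN u)).
  move=> x [/AN[n _ Nx]|/BN'[n _ Nx]]; first by exists (true, n).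
  by exists (false, n).
by apply: meager_bigcup => -[[] n]; [exact: nN|exact: nN'].
Qed.

Lemma meager_bigcup_meager (I : countType) (A : I -> set T) :
  (forall i, meager (A i)) -> meager (\bigcup_i A i).
Proof.
move=> mA; have /choice[N NP] : forall i, exists N : nat -> set T,
    (forall n, nowhere_dense (N n)) /\ A i `<=` \bigcup_n N n.
  by move=> i; have [N ? ?] := mA i; exists N.
apply: (@meager_sub _ (\bigcup_(u : I * nat) N u.1 u.2)).
  by move=> x [i _ /(NP i).2[n _ Nx]]; exists (i, n).
by apply: meager_bigcup => u; exact: (NP u.1).1.
Qed.

Lemma not_closure A x : nbhs x (~` A) -> ~ closure A x.
Proof. by move=> nA clA; have [y [Ay nAy]] := clA _ nA; exact: nAy. Qed.

(** The half of the Kuratowski-Ulam theorem needed below, for the preimage of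
    [N] under [m]: generic horizontal sections of it are nowhere dense. A
    section over [y] fails to be nowhere dense only if its closure contains a
    basic open set [b n], in which case [m] maps [b n] times [y] into the
    closure of [N]. Each of the countably many sets of such [y] is nowhere
    dense, as [m] sends neighbourhoods of a pair to neighbourhoods: the image of
    [b n] times an open set cannot lie in the closure of [N]. *)
Lemma generic_section (m : T -> T -> T) N :
  @second_countable T ->
  (forall x, continuous (m x)) -> (forall y, continuous (m^~ y)) ->
  (forall x y B O, nbhs x B -> nbhs y O ->
     nbhs (m x y) [set z | exists x' y', [/\ B x', O y' & z = m x' y']]) ->
  nowhere_dense N ->
  meager [set y | ~ nowhere_dense [set x | N (m x y)]].
Proof.
move=> [Bs cBs [oBs basisBs]] cx cy opm /nowhere_denseP nN.
have off_N (f : T -> T) x : continuous f -> ~ closure N (f x) ->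
    nbhs x [set x' | ~ closure N (f x')].
  move=> cf Nfx; apply: (cf x (~` closure N)).
  apply: open_nbhs_nbhs; split=> //.
  exact/closed_openC/closed_closure.
have /pfcard_geP[Bs0|[b]] := cBs.
  exists (fun=> set0).
    by move=> _; rewrite /nowhere_dense closure0 interior0.
  by move=> y _; have [U []] := basisBs y setT filterT; rewrite Bs0.
pose bad n := [set y | b n !=set0 /\ forall x, b n x -> closure N (m x y)].
have oB n : open (b n) by apply: oBs; exact: funS.
exists bad => [n|y ny].
  apply/nowhere_denseP => O oO [y Oy].
  have [[x bx]|b0] := pselect (b n !=set0); last first.
    by exists y => //; apply: not_closure; apply: nearW => z [].
  have W := opm x y (b n) O (open_nbhs_nbhs (conj (oB n) bx))
    (open_nbhs_nbhs (conj oO Oy)).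
  have [z /interior_subset[x' [y' [bx' Oy' zE]]]] :=
    nN _ (open_interior _) (ex_intro _ (m x y) W).
  rewrite zE => Nz.
  exists y' => //; apply: not_closure.
  apply: filterS (off_N _ _ (cx x') Nz) => z' Nz'.
  by case=> _ clN; exact: Nz' (clN _ bx').
apply: contrapT => nby; apply: ny; apply/nowhere_denseP => O oO [x Ox].
have [U [/(@surj _ _ _ _ b)[n _ bU] Ux] UO] :=
  basisBs x O (open_nbhs_nbhs (conj oO Ox)).
have [x' [bx' Nx']] : exists x', b n x' /\ ~ closure N (m x' y).
  apply: contrapT => nx'; apply: nby; exists n => //; split.
    by exists x; rewrite bU.
  by move=> x' bx'; apply: contrapT => Nx'; apply: nx'; exists x'.
exists x'; first by apply: UO; rewrite -bU.
apply: not_closure; apply: filterS (off_N _ _ (cy y) Nx') => z Nz.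
by move=> Nzy; apply: Nz; exact: subset_closure.
Qed.

End category.

(** * Measures with a density *)

Section density.
Local Open Scope ereal_scope.
Context d (T : measurableType d) (R : realType).
Implicit Types (mu : {measure set T -> \bar R}) (g : T -> R).

(** The two propositional arguments are kept in the term so that the measure
    structure below can be inferred from it. *)
Definition density mu g of measurable_fun setT g & (forall x, 0 <= g x)%R :=
  fun A : set T => \int[mu]_(x in A) (g x)%:E.

Variables (mu : {measure set T -> \bar R}) (g : T -> R).
Hypotheses (mg : measurable_fun setT g) (g0 : forall x, (0 <= g x)%R).

Local Notation nu := (density mu mg g0).

Let mEg A : measurable_fun A (EFin \o g).
Proof. exact/measurable_EFinP/measurable_funTS. Qed.

Let nu0 : nu set0 = 0.
Proof. exact: integral_set0. Qed.

Let nu_ge0 A : 0 <= nu A.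
Proof. by apply: integral_ge0 => x _; rewrite lee_fin. Qed.

Let nu_sigma_additive : semi_sigma_additive nu.
Proof.
move=> F mF tF mUF; rewrite /density ge0_integral_bigcup//.
- apply: is_cvg_nneseries => n _ _; apply: integral_ge0 => x _.
  by rewrite lee_fin.
- by move=> x _; rewrite lee_fin.
Qed.

HB.instance Definition _ :=
  isMeasure.Build _ _ _ nu nu0 nu_ge0 nu_sigma_additive.

Import HBNNSimple.

(** Both sides are continuous along the increasing approximation of [f] by
    simple functions, and for a simple function the identity reduces, level set
    by level set, to the definition of [density]. *)
Lemma integral_density (f : T -> \bar R) : measurable_fun setT f ->
  (forall x, 0 <= f x) ->
  \int[nu]_x f x = \int[mu]_x (f x * (g x)%:E).
Proof.
move=> mf f0; pose h := nnsfun_approx measurableT mf.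
have hf x : EFin \o h^~ x @ \oo --> f x by exact: cvg_nnsfun_approx.
have -> : \int[nu]_x f x = lim (\int[nu]_x (h n x)%:E @[n --> \oo]).
  rewrite -monotone_convergence//=.
  - by apply: eq_integral => x _; apply/esym/cvg_lim => //; exact: hf.
  - by move=> n; exact/measurable_EFinP.
  - by move=> n x _; rewrite lee_fin.
  - by move=> x _ a b ab; rewrite lee_fin; exact/lefP/nd_nnsfun_approx.
have -> : \int[mu]_x (f x * (g x)%:E) =
    lim (\int[mu]_x ((h n x)%:E * (g x)%:E) @[n --> \oo]).
  rewrite -monotone_convergence//=.
  - apply: eq_integral => x _; apply/esym/cvg_lim => //.
    by apply: cvgeZr => //; exact: hf.
  - by move=> n; apply: emeasurable_funM; [exact/measurable_EFinP|exact: mEg].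
  - by move=> n x _; rewrite mule_ge0 ?lee_fin.
  - move=> x _ a b ab; rewrite lee_wpmul2r ?lee_fin//.
    exact/lefP/nd_nnsfun_approx.
congr (limn _); apply/funext => n.
transitivity (\int[nu]_x
   (\sum_(y \in range (h n)) (y * \1_(h n @^-1` [set y]) x)%:E)).
  by apply: eq_integral => t _; rewrite /= fimfunE -fsumEFin.
have mi (r : R) :
    measurable_fun setT (fun x => (r * \1_(h n @^-1` [set r]) x)%:E).
  exact/measurable_EFinP/measurable_funM.
rewrite ge0_integral_fsum//; last by move=> m y _; exact: nnfun_muleindic_ge0.
transitivity (\int[mu]_x (\sum_(y \in range (h n))
    (y * \1_(h n @^-1` [set y]) x)%:E * (g x)%:E)); last first.
  apply: eq_integral => x _.
  rewrite -ge0_mule_fsuml => [|y]; last exact: nnfun_muleindic_ge0.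
  by rewrite fsumEFin // -(fimfunE _ x).
rewrite ge0_integral_fsum//; last 2 first.
  - by move=> y; apply: emeasurable_funM => //; exact: mEg.
  - by move=> m y _; rewrite mule_ge0 ?lee_fin// -lee_fin nnfun_muleindic_ge0.
apply: eq_fsbigr => r rh.
under eq_integral do rewrite EFinM.
rewrite integralZl_indic_nnsfun => //.
under [RHS]eq_integral do rewrite EFinM -muleA.
rewrite [RHS]ge0_integralZl//.
- under [in RHS]eq_integral do rewrite muleC.
  rewrite (_ : \int[mu]_x _ =
      \int[mu]_x ((EFin \o g) \_ (h n @^-1` [set r])) x); last first.
    by apply: eq_integral => x xE; rewrite epatch_indic.
  by rewrite -integral_mkcond integral_indic// setIT.
- apply: emeasurable_funM; first exact/measurable_EFinP.
  exact: mEg.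
- by move=> t Et; rewrite mule_ge0 ?lee_fin.
- by move: rh; rewrite inE => -[t _ <-]; rewrite lee_fin.
Qed.

End density.

(** * Integrals of bounded continuous functions *)

Section bcont.
Context {X : ptopologicalType} {R : realType}.
Implicit Types (f g : X -> R) (mu nu : borel_prob X R).

(** The predicate of the test functions of the weak topology. *)
Definition bcont f := continuous f /\ bounded_fun f.

Lemma bounded_funP f : bounded_fun f <-> exists M, forall x, `|f x| <= M.
Proof.
split=> [[M [_ Mf]]|[M fM]].
  by exists (M + 1) => x; apply: Mf => //; rewrite ltrDl.
exists M; split; first exact: num_real.
by move=> N MN x _; apply: (le_trans (fM x)); exact: ltW.
Qed.

Lemma bcont_bound f : bcont f -> exists2 M : R, 0 < M & forall x, `|f x| <= M.
Proof.
move=> [_ /bounded_funP[M fM]]; exists (`|M| + 1); first by rewrite ltr_wpDl.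
by move=> x; rewrite (le_trans (fM x))// (le_trans (ler_norm _))// lerDl.
Qed.

Lemma bcont_of_bound f M : continuous f -> (forall x, `|f x| <= M) -> bcont f.
Proof. by move=> cf fM; split => //; apply/bounded_funP; exists M. Qed.

Lemma bcont_cst (a : R) : bcont (fun=> a).
Proof. by apply: (@bcont_of_bound _ `|a|) => [x|//]; exact: cvg_cst. Qed.

Lemma bcontD f g : bcont f -> bcont g -> bcont (fun x => f x + g x).
Proof.
move=> cf cg; have [M _ fM] := bcont_bound cf; have [N _ gN] := bcont_bound cg.
apply: (@bcont_of_bound _ (M + N)) => x.
  by apply: cvgD; [exact: cf.1|exact: cg.1].
by rewrite (le_trans (ler_normD _ _))// lerD.
Qed.

Lemma bcontM f g : bcont f -> bcont g -> bcont (fun x => f x * g x).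
Proof.
move=> cf cg; have [M _ fM] := bcont_bound cf; have [N _ gN] := bcont_bound cg.
apply: (@bcont_of_bound _ (M * N)) => x.
  by apply: cvgM; [exact: cf.1|exact: cg.1].
by rewrite normrM ler_pM.
Qed.

Lemma bcontN f : bcont f -> bcont (fun x => - f x).
Proof.
move=> cf; have := bcontM (bcont_cst (-1)) cf.
by congr bcont; apply/funext => x; rewrite mulN1r.
Qed.

Lemma bcontB f g : bcont f -> bcont g -> bcont (fun x => f x - g x).
Proof. by move=> cf cg; apply: bcontD => //; exact: bcontN. Qed.

Lemma bcont_max f g : bcont f -> bcont g ->
  bcont (fun x => Num.max (f x) (g x)).
Proof.
move=> cf cg; have [M M0 fM] := bcont_bound cf.
have [N N0 gN] := bcont_bound cg.
apply: (@bcont_of_bound _ (M + N)) => x.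
  by apply: continuous_max; [exact: cf.1|exact: cg.1].
case: (ltP (f x) (g x)) => _; first by rewrite (le_trans (gN x))// lerDr ltW.
by rewrite (le_trans (fM x))// lerDl ltW.
Qed.

Lemma bcont_sum I (s : seq I) (F : I -> X -> R) :
  (forall i, bcont (F i)) -> bcont (fun x => \sum_(i <- s) F i x).
Proof.
move=> cF; elim: s => [|i s ih].
  by have := bcont_cst 0; congr bcont; apply/funext => x; rewrite big_nil.
by have := bcontD (cF i) ih; congr bcont; apply/funext => x; rewrite big_cons.
Qed.

Lemma bcont_measurable f : bcont f ->
  measurable_fun setT (f : borel X -> R).
Proof.
move=> [/continuousP cf _].
apply: (measurability _ (measurable_realfun.RGenOpens.measurableE R)).
move=> _ [_ [a [b ->]] <-]; apply: sub_sigma_algebra; rewrite setTI.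
exact/cf/interval_open.
Qed.

Lemma bcont_integrable mu f : bcont f ->
  mu.-integrable setT (EFin \o (f : borel X -> R)).
Proof.
move=> cf; apply: measurable_bounded_integrable => //.
- by rewrite -ge0_fin_numE ?fin_num_measure.
- exact: bcont_measurable.
- exact: cf.2.
Qed.

Lemma int_cst mu (a : R) : \int[mu]_x a = a.
Proof.
rewrite Rintegral_cst// -[RHS]mulr1; congr (_ * _).
exact: (f_equal fine (probability_setT mu)).
Qed.

Lemma intD mu f g : bcont f -> bcont g ->
  \int[mu]_x (f x + g x) = \int[mu]_x f x + \int[mu]_x g x.
Proof. by move=> cf cg; apply: RintegralD => //; exact: bcont_integrable. Qed.

Lemma intB mu f g : bcont f -> bcont g ->
  \int[mu]_x (f x - g x) = \int[mu]_x f x - \int[mu]_x g x.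
Proof. by move=> cf cg; apply: RintegralB => //; exact: bcont_integrable. Qed.

Lemma intZ mu a f : bcont f ->
  \int[mu]_x (a * f x) = a * \int[mu]_x f x.
Proof. by move=> cf; apply: RintegralZl => //; exact: bcont_integrable. Qed.

Lemma int_sum mu I (s : seq I) (F : I -> X -> R) :
  (forall i, bcont (F i)) ->
  \int[mu]_x (\sum_(i <- s) F i x) = \sum_(i <- s) \int[mu]_x F i x.
Proof.
move=> cF; elim: s => [|i s ih].
  under eq_Rintegral do rewrite big_nil.
  by rewrite big_nil int_cst.
under eq_Rintegral do rewrite big_cons.
by rewrite big_cons -ih; apply: intD => //; exact: bcont_sum.
Qed.

Lemma le_int mu f g : bcont f -> bcont g -> (forall x, f x <= g x) ->
  \int[mu]_x f x <= \int[mu]_x g x.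
Proof.
by move=> cf cg fg; apply: le_Rintegral => //; exact: bcont_integrable.
Qed.

Lemma int_normr mu f g : bcont f -> bcont g -> (forall x, `|f x| <= g x) ->
  `|\int[mu]_x f x| <= \int[mu]_x g x.
Proof.
move=> cf cg fg; rewrite ler_norml; apply/andP; split; last first.
  by apply: le_int => // x; rewrite (le_trans (ler_norm _)).
rewrite -mulN1r -intZ//; apply: le_int => //.
  by apply: bcontM => //; exact: bcont_cst.
by move=> x; rewrite mulN1r; have := fg x; rewrite ler_norml => /andP[].
Qed.

Lemma EFin_int mu f : bcont f ->
  (\int[mu]_x f x)%:E = (\int[mu]_x (f x)%:E)%E.
Proof.
move=> cf; rewrite /Rintegral fineK//; apply: integrable_fin_num => //.
exact: bcont_integrable.
Qed.

(** A bounded function becomes nonnegative after adding a constant, so a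
    functional that shifts by additive constants, as the integral against a
    probability does, is determined by its values on nonnegative functions. *)
Lemma int_ge0_ext (L : (X -> R) -> R) mu :
  (forall f (a : R), bcont f -> L (fun x => f x + a) = L f + a) ->
  (forall f, bcont f -> (forall x, 0 <= f x) -> \int[mu]_x f x = L f) ->
  forall f, bcont f -> \int[mu]_x f x = L f.
Proof.
move=> LD L0 f cf; have [M M0 fM] := bcont_bound cf.
have cfM : bcont (fun x => f x + M) by apply: bcontD => //; exact: bcont_cst.
apply: (@addIr _ M); rewrite -LD// -L0//.
  by rewrite intD ?int_cst//; exact: bcont_cst.
by move=> x; have := fM x; rewrite ler_norml => /andP[]; lra.
Qed.

Lemma int_mix t mu nu f : bcont f ->
  \int[mix t mu nu]_x f x =
  t%:num * \int[mu]_x f x + (1 - t%:num) * \int[nu]_x f x.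
Proof.
move: f; apply: int_ge0_ext => [f a cf|f cf f0].
  rewrite !intD ?int_cst//; try exact: bcont_cst.
  by ring.
have t0 : 0 <= t%:num by [].
have t1 : 0 <= 1 - t%:num by rewrite subr_ge0.
have mf : measurable_fun setT (fun x : borel X => (f x)%:E).
  by apply/measurable_EFinP; exact: bcont_measurable.
have f0' : forall x : borel X, setT x -> (0 <= (f x)%:E)%E.
  by move=> x _; rewrite lee_fin.
apply: EFin_inj; rewrite EFinD !EFinM !EFin_int//.
have := ge0_integral_mscale mu measurableT (NngNum t0) mf f0' => /= <-.
have := ge0_integral_mscale nu measurableT (NngNum t1) mf f0' => /= <-.
rewrite -ge0_integral_measure_add//.
by apply: eq_measure_integral => A mA _; apply: esym; exact: measure_addE.
Qed.

End bcont.

Section split.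
Context {X : ptopologicalType} {R : realType}.
Implicit Types (f g : X -> R) (mu nu lam : borel_prob X R).

Lemma exists_density lam g : bcont g -> (forall x, 0 <= g x) ->
    \int[lam]_x g x = 1 ->
  exists mu : borel_prob X R,
    (forall A : set (borel X), measurable A ->
       mu A = (\int[lam]_(x in A) (g x)%:E)%E) /\
    (forall f, bcont f -> \int[mu]_x f x = \int[lam]_x (f x * g x)).
Proof.
move=> cg g0 g1.
have mg := bcont_measurable cg.
pose m : {measure set (borel X) -> \bar R} := density lam mg g0.
have mT : m setT = 1%E by rewrite -g1 EFin_int.
pose mP := Measure_isProbability.Build _ _ _ m mT.
pose P : probability (borel X) R := HB.pack (m : set _ -> _) m mP.
have [mu muP] := borel_prob_of P.
exists mu; split; first exact: muP.
have gb f : bcont f -> bcont (fun x => f x * g x) by move=> cf; exact: bcontM.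
move=> f; move: f; apply: int_ge0_ext => [f a cf|f cf f0].
  under eq_Rintegral do rewrite mulrDl.
  rewrite intD//; [|exact: gb|by apply: bcontM => //; exact: bcont_cst].
  by rewrite intZ// g1 mulr1.
have mf : measurable_fun setT (fun x : borel X => (f x)%:E).
  by apply/measurable_EFinP; exact: bcont_measurable.
have f0' : forall x : borel X, (0 <= (f x)%:E)%E by move=> x; rewrite lee_fin.
apply: EFin_inj; rewrite !EFin_int//; last exact: gb.
have := integral_density lam mg g0 mf f0'.
under [in X in _ = X -> _]eq_integral do rewrite -EFinM.
by move=> <-; apply: eq_measure_integral => A mA _; exact: muP.
Qed.

(** Cutting [lam] along [g]: the two pieces are the normalizations of the
    measures with densities [g] and [1 - g] with respect to [lam]. *)
Lemma split_by_density lam g (t : {i01 R}) : 0 < t%:num < 1 ->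
    bcont g -> (forall x, 0 <= g x <= 1) -> \int[lam]_x g x = t%:num ->
  exists mu nu : borel_prob X R,
    [/\ lam = mix t mu nu,
     forall f, bcont f -> t%:num * \int[mu]_x f x = \int[lam]_x (f x * g x) &
     forall f, bcont f ->
       (1 - t%:num) * \int[nu]_x f x = \int[lam]_x (f x * (1 - g x))].
Proof.
move=> /andP[t0 t1] cg g01 gt.
have t1' : 0 < 1 - t%:num by rewrite subr_gt0.
have cg1 : bcont (fun x => 1 - g x) by apply: bcontB => //; exact: bcont_cst.
have cgt (a : R) h : bcont h -> bcont (fun x : X => a * h x).
  by move=> ch; apply: bcontM => //; exact: bcont_cst.
have [mu [muA muf]] : exists mu : borel_prob X R,
    (forall A : set (borel X), measurable A ->
       mu A = (\int[lam]_(x in A) (t%:num^-1 * g x)%:E)%E) /\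
    (forall f, bcont f ->
       \int[mu]_x f x = \int[lam]_x (f x * (t%:num^-1 * g x))).
  apply: exists_density; first exact: cgt.
    by move=> x; rewrite mulr_ge0 ?invr_ge0//; have /andP[] := g01 x.
  by rewrite intZ// gt mulVf// gt_eqF.
have [nu [nuA nuf]] : exists nu : borel_prob X R,
    (forall A : set (borel X), measurable A ->
       nu A = (\int[lam]_(x in A) ((1 - t%:num)^-1 * (1 - g x))%:E)%E) /\
    (forall f, bcont f ->
       \int[nu]_x f x = \int[lam]_x (f x * ((1 - t%:num)^-1 * (1 - g x)))).
  apply: exists_density; first exact: cgt.
    move=> x; rewrite mulr_ge0 ?invr_ge0//.
    by rewrite subr_ge0; have /andP[] := g01 x.
  rewrite intZ// intB//; last exact: bcont_cst.
  by rewrite int_cst gt mulVf// gt_eqF.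
exists mu, nu; split.
- apply: borel_prob_ext => A mA; rewrite /mix/= /mixture muA// nuA//.
  have mh (h : X -> R) : bcont h ->
      measurable_fun A (fun x : borel X => (h x)%:E).
    move=> ch; apply: (measurable_funS measurableT) => //.
    by apply/measurable_EFinP; exact: bcont_measurable.
  have p1 x : A x -> (0 <= (t%:num^-1 * g x)%:E)%E.
    by move=> _; rewrite lee_fin mulr_ge0 ?invr_ge0//; have /andP[] := g01 x.
  have p2 x : A x -> (0 <= ((1 - t%:num)^-1 * (1 - g x))%:E)%E.
    move=> _; rewrite lee_fin mulr_ge0 ?invr_ge0//.
    by rewrite subr_ge0; have /andP[] := g01 x.
  have m1 := mh _ (cgt t%:num^-1 _ cg).
  have m2 := mh _ (cgt (1 - t%:num)^-1 _ cg1).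
  rewrite -!ge0_integralZl//.
  rewrite -ge0_integralD//; first last.
  - exact: mh (cgt _ _ (cgt _ _ cg1)).
  - by move=> x Ax; rewrite mule_ge0// ?p2// lee_fin.
  - exact: mh (cgt _ _ (cgt _ _ cg)).
  - by move=> x Ax; rewrite mule_ge0// ?p1// lee_fin.
  under eq_integral => x _.
    rewrite -!EFinM -EFinD !mulrA !mulfV ?gt_eqF// !mul1r addrC subrK.
    over.
  by rewrite integral_cst//; apply: esym; exact: mul1e.
- move=> f cf; rewrite muf// -intZ//; last exact: bcontM (cgt _ _ cg).
  by apply: eq_Rintegral => x _; rewrite mulrCA mulVKf// gt_eqF.
- move=> f cf; rewrite nuf// -intZ//; last exact: bcontM (cgt _ _ cg1).
  by apply: eq_Rintegral => x _; rewrite mulrCA mulVKf// gt_eqF.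
Qed.

End split.

(** * The weak topology *)

Section weak.
Context {X : ptopologicalType} {R : realType}.
Implicit Types (f g : X -> R) (mu nu lam : borel_prob X R).

Lemma continuous_int f : bcont f ->
  continuous (fun mu : borel_prob X R => \int[mu]_x f x : R).
Proof.
move=> [cf bf] mu.
by have [/(_ (fun _ => id)) /(_ f cf bf)] := @weak_cvgP X R (nbhs mu) mu _.
Qed.

(** The sets [A] satisfying the conclusion form a filter along which every
    integral converges to its value at [mu]; by definition of the weak topology
    that filter converges to [mu]. *)
Lemma weak_nbhsP mu (A : set (borel_prob X R)) : nbhs mu A ->
  exists (I : finType) (f : I -> X -> R) (e : R),
    [/\ forall i, bcont (f i), 0 < e &
     forall nu, (forall i, `|\int[nu]_x f i x - \int[mu]_x f i x| < e) -> A nu].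
Proof.
pose G : set_system (borel_prob X R) := [set A |
  exists (I : finType) (f : I -> X -> R) (e : R),
    [/\ forall i, bcont (f i), 0 < e &
     forall nu, (forall i, `|\int[nu]_x f i x - \int[mu]_x f i x| < e) ->
       A nu]].
have FG : Filter G.
  split.
  - by exists void, (fun=> cst 0), 1; split => //; case.
  - move=> P Q [I [f [e [cf e0 fP]]]] [J [g [d [cg d0 gQ]]]].
    exists (I + J)%type.
    exists (fun k => match k with inl i => f i | inr j => g j end).
    exists (Num.min e d); split; first by case.
      by rewrite lt_min e0 d0.
    move=> nu h; split.
      by apply: fP => i; have := h (inl i); rewrite lt_min => /andP[].
    by apply: gQ => j; have := h (inr j); rewrite lt_min => /andP[].
  - move=> P Q PQ [I [f [e [cf e0 fP]]]]; exists I, f, e; split => // nu h.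
    exact/PQ/fP.
suff : G --> mu by apply.
apply/weak_cvgP => f cf bf; apply/cvgrPdist_lt => e e0.
exists unit, (fun=> f), e; split => // nu /(_ tt).
by rewrite distrC.
Qed.

(** Joint continuity of the mixture in the weight and the two measures; stated
    with filters to cover both separate continuity and weights tending to 0. *)
Lemma mix_cvg (T : Type) (F : set_system T) (FF : Filter F)
    (t : T -> {i01 R}) (u v : T -> borel_prob X R) (s : {i01 R}) mu nu :
  (t x)%:num @[x --> F] --> s%:num -> u x @[x --> F] --> mu ->
  v x @[x --> F] --> nu -> mix (t x) (u x) (v x) @[x --> F] --> mix s mu nu.
Proof.
move=> ts um vn; apply/weak_cvgP => f cf bf.
have bcf : bcont f by [].
have fu : \int[u x]_y f y @[x --> F] --> \int[mu]_y f y.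
  exact: (cvg_trans (cvg_app (fun m : borel_prob X R => \int[m]_y f y) um)
    (@continuous_int f bcf mu)).
have fv : \int[v x]_y f y @[x --> F] --> \int[nu]_y f y.
  exact: (cvg_trans (cvg_app (fun m : borel_prob X R => \int[m]_y f y) vn)
    (@continuous_int f bcf nu)).
rewrite int_mix//.
suff : (fun x => \int[mix (t x) (u x) (v x)]_y f y : R) @ F -->
    s%:num * \int[mu]_y f y + (1 - s%:num) * \int[nu]_y f y by [].
under eq_fun do rewrite int_mix//.
apply: cvgD; apply: cvgM => //; apply: cvgB => //; exact: cvg_cst.
Qed.

End weak.

(** * Partitions of unity *)

Section hat.
Context {R : realType}.
Implicit Types y : R.

Definition clip y : R := Num.max 0 (Num.min 1 y).
(** The tent of height 1 on the interval from [j - 1] to [j + 1]; this form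
    makes the sum over consecutive [j] telescope. *)
Definition hat (j : nat) y := clip (y + 1 - j%:R) - clip (y - j%:R).

Lemma continuous_clip : continuous clip.
Proof.
move=> y; apply: continuous_max; first exact: cvg_cst.
by apply: continuous_min; [exact: cvg_cst|exact: cvg_id].
Qed.

Lemma clip0 y : y <= 0 -> clip y = 0.
Proof. by move=> y0; rewrite /clip (min_idPr _) ?(max_idPl _)//; lra. Qed.

Lemma clip1 y : 1 <= y -> clip y = 1.
Proof. by move=> y0; rewrite /clip (min_idPl _) ?(max_idPr _). Qed.

Lemma clip_le y z : y <= z -> clip y <= clip z.
Proof.
by move=> yz; rewrite /clip ge_max !le_max lexx/= le_min !ge_min lexx yz !orbT.
Qed.

Lemma continuous_hat j : continuous (hat j).
Proof.
have cc a : continuous (fun y => clip (y + a)).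
  move=> y; apply: (@continuous_comp _ _ _ (fun z => z + a) clip).
    by apply: cvgD; [exact: cvg_id|exact: cvg_cst].
  exact: continuous_clip.
move=> y; apply: cvgB; last exact: cc.
by under eq_fun do rewrite -addrA; rewrite -addrA; exact: cc.
Qed.

Lemma hat_ge0 j y : 0 <= hat j y.
Proof. by rewrite subr_ge0 clip_le//; lra. Qed.

Lemma hat_far j y : hat j y != 0 -> `|y - j%:R| <= 1.
Proof.
apply: contraNT; rewrite -ltNge => h; apply/eqP.
have [jy|yj] := leP (j%:R : R) y.
  by move: h; rewrite ger0_norm ?subr_ge0// => h; rewrite /hat !clip1//; lra.
by move: h; rewrite ltr0_norm ?subr_lt0// => h; rewrite /hat !clip0//; lra.
Qed.

Lemma sum_hat N y : 0 <= y -> y + 1 <= N%:R -> \sum_(j < N) hat j y = 1.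
Proof.
move=> y0 yN.
have -> : \sum_(j < N) hat j y = clip (y + 1) - clip (y + 1 - N%:R).
  elim: N {yN} => [|N ih]; first by rewrite big_ord0 subr0 subrr.
  rewrite big_ord_recr /= ih /hat addrA subrK; congr (_ - clip _).
  by rewrite -[N.+1]addn1 natrD; lra.
by rewrite clip1 ?clip0 ?subr0//; lra.
Qed.

End hat.

Section partition.
Context {X : ptopologicalType} {R : realType}.
Implicit Types (f g : X -> R) (mu nu lam : borel_prob X R).

Lemma bcont_bound_fin (I : finType) (f : I -> X -> R) :
  (forall i, bcont (f i)) -> exists2 M : R, 0 < M & forall i x, `|f i x| <= M.
Proof.
move=> cf.
have /choice[M MP] : forall i, exists M,
    0 < M /\ forall x, `|f i x| <= M.
  by move=> i; have [M ? ?] := bcont_bound (cf i); exists M.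
exists (1 + \sum_i M i).
  by rewrite ltr_wpDr// sumr_ge0// => i _; exact/ltW/(MP i).1.
move=> i x; rewrite (bigD1 i)//= addrCA (le_trans ((MP i).2 x))// lerDl.
by rewrite addr_ge0// sumr_ge0// => j _; exact/ltW/(MP j).1.
Qed.

(** The function [c k i] of the statement is a value that [f i] approximates to
    within [e] on the support of [phi k]. Tents on a grid of step [e], composed
    with [f i], give a partition for one function; the partition for the family
    consists of all products of one tent per function, so it is indexed by
    functions from [I] to the grid. *)
Lemma partition_of_unity (I : finType) (f : I -> X -> R) (e : R) :
    (forall i, bcont (f i)) -> 0 < e ->
  exists (K : finType) (phi : K -> X -> R) (c : K -> I -> R),
    [/\ forall k, bcont (phi k), forall k x, 0 <= phi k x,
        forall x, \sum_k phi k x = 1 &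
        forall k i x, `|(f i x - c k i) * phi k x| <= e * phi k x].
Proof.
move=> cf e0; have [M M0 fM] := bcont_bound_fin cf.
(* the height of [f i] above [- M], in steps of the grid *)
pose y i x := (f i x + M) / e.
pose N := (Num.truncn (2 * M / e + 1)).+1.
have y0 i x : 0 <= y i x.
  apply: divr_ge0; last exact: ltW.
  by have := fM i x; rewrite ler_norml => /andP[]; lra.
have yN i x : y i x + 1 <= N%:R.
  apply: le_trans (ltW (truncnS_gt _)); rewrite lerD2r ler_pM2r ?invr_gt0//.
  by have := fM i x; rewrite ler_norml => /andP[]; lra.
pose phi (k : {ffun I -> 'I_N}) x := \prod_i hat (k i) (y i x).
have cy i : continuous (y i).
  move=> x; apply: cvgM; last exact: cvg_cst.
  by apply: cvgD; [exact: (cf i).1|exact: cvg_cst].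
have phi0 k x : 0 <= phi k x by apply: prodr_ge0 => i _; exact: hat_ge0.
have phi1 x : \sum_k phi k x = 1.
  rewrite -(bigA_distr_bigA (fun i (j : 'I_N) => hat j (y i x))).
  by rewrite big1// => i _; exact: sum_hat.
exists {ffun I -> 'I_N}, phi.
exists (fun (k : {ffun I -> 'I_N}) i => (k i)%:R * e - M); split => //.
- move=> k; apply: (@bcont_of_bound _ _ _ 1) => x.
    apply: cvg_big => [|i _]; first exact: mul_continuous.
    apply: (@continuous_comp _ _ _ (y i) (hat (k i))); first exact: cy.
    exact: continuous_hat.
  rewrite ger0_norm// -(phi1 x) (bigD1 k)//= lerDl sumr_ge0//.
- move=> k i x; rewrite normrM (ger0_norm (phi0 k x)).
  have [->|phi_neq0] := eqVneq (phi k x) 0; first by rewrite !mulr0.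
  apply: ler_wpM2r => //.
  have : hat (k i) (y i x) != 0.
    by apply: contra_neq phi_neq0 => h; rewrite /phi (bigD1 i)//= h mul0r.
  move=> /hat_far near_k.
  have -> : f i x - ((k i)%:R * e - M) = (y i x - (k i)%:R) * e.
    by rewrite mulrBl divfK ?gt_eqF//; ring.
  by rewrite normrM (gtr0_norm e0) -[leRHS]mul1r ler_pM2r.
Qed.

End partition.

(** * The mixture is an open map *)

Section open_mix.
Context {X : ptopologicalType} {R : realType}.
Implicit Types (f g : X -> R) (mu nu lam : borel_prob X R).

(** The density of [t mu] with respect to the mixture, coarsened to be constant,
    with value [c k], on each piece of a fine partition of unity. The value is
    the ratio of the masses that [t mu] and the mixture give to the piece;
    where the mixture gives mass 0 so does [t mu], so the value 0 that division
    by zero yields there is harmless. *)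
Lemma exists_cut (t : {i01 R}) mu nu (I : finType) (f : I -> X -> R) (e : R) :
    (forall i, bcont (f i)) -> 0 < e ->
  exists g, [/\ bcont g, forall x, 0 <= g x <= 1,
    \int[mix t mu nu]_x g x = t%:num &
    forall i, `|\int[mix t mu nu]_x (f i x * g x) - t%:num * \int[mu]_x f i x|
              <= e].
Proof.
move=> cf e0; set lam := mix t mu nu.
have e20 : 0 < e / 2 by rewrite divr_gt0.
have [K [phi [v [cphi phi0 phi1 phiv]]]] := partition_of_unity cf e20.
pose a k := \int[mu]_x phi k x; pose l k := \int[lam]_x phi k x.
have int0 (m : borel_prob X R) k : 0 <= \int[m]_x phi k x :> R.
  exact: Rintegral_ge0.
have sum1 (m : borel_prob X R) : \sum_k \int[m]_x phi k x = 1 :> R.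
  rewrite -int_sum//; under eq_Rintegral do rewrite phi1.
  exact: int_cst.
have t0 : 0 <= t%:num by [].
have t1 : t%:num <= 1 by [].
have al k : t%:num * a k <= l k.
  by rewrite /l int_mix// lerDl mulr_ge0// subr_ge0.
pose c k := t%:num * a k / l k.
have ta0 k : 0 <= t%:num * a k by rewrite mulr_ge0// int0.
have cl k : c k * l k = t%:num * a k.
  have [l0|l0] := eqVneq (l k) 0; last by rewrite divfK.
  by have := al k; rewrite l0 mulr0 => ?; apply/eqP; rewrite eq_le ta0.
have c0 k : 0 <= c k by rewrite divr_ge0// int0.
have c1 k : c k <= 1.
  have := int0 lam k; rewrite le_eqVlt => /predU1P[l0|l0].
    by rewrite /c /l -l0 invr0 mulr0.
  by rewrite ler_pdivrMr// mul1r.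
have ccphi k : bcont (fun x => c k * phi k x).
  by apply: bcontM => //; exact: bcont_cst.
exists (fun x => \sum_k c k * phi k x); split.
- exact: bcont_sum.
- move=> x; rewrite sumr_ge0 => [/=|k _]; last exact: mulr_ge0.
  rewrite -(phi1 x); apply: ler_sum => k _; rewrite -[leRHS]mul1r.
  exact: ler_wpM2r.
- rewrite int_sum//; under eq_bigr do rewrite intZ// cl.
  by rewrite -mulr_sumr sum1 mulr1.
move=> i.
have cfphi k : bcont (fun x => f i x * phi k x) by exact: bcontM.
have -> : \int[lam]_x (f i x * \sum_k c k * phi k x) =
    \sum_k c k * \int[lam]_x (f i x * phi k x).
  under eq_bigr do rewrite -intZ//.
  rewrite -int_sum => [|k]; last by apply: bcontM => //; exact: bcont_cst.
  apply: eq_Rintegral => x _; rewrite mulr_sumr.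
  by apply: eq_bigr => k _; rewrite mulrCA.
have -> : \int[mu]_x f i x = \sum_k \int[mu]_x (f i x * phi k x).
  rewrite -int_sum//; apply: eq_Rintegral => x _.
  by rewrite -mulr_sumr phi1 mulr1.
rewrite mulr_sumr -sumrB.
have near_v (m : borel_prob X R) k :
    `|\int[m]_x (f i x * phi k x) - v k i * \int[m]_x phi k x|
    <= e / 2 * \int[m]_x phi k x.
  have cv : bcont (fun x => v k i * phi k x).
    by apply: bcontM => //; exact: bcont_cst.
  rewrite -!intZ// -intB//; apply: int_normr.
  - exact: bcontB.
  - by apply: bcontM => //; exact: bcont_cst.
  - by move=> x; rewrite -mulrBl.
apply: (@le_trans _ _ (\sum_k e * (t%:num * a k))); last first.
  by rewrite -!mulr_sumr sum1 mulr1 ler_piMr// ltW.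
apply: le_trans (ler_norm_sum _ _ _) _; apply: ler_sum => k _.
have -> : c k * \int[lam]_x (f i x * phi k x) -
      t%:num * \int[mu]_x (f i x * phi k x) =
    c k * (\int[lam]_x (f i x * phi k x) - v k i * l k) -
    t%:num * (\int[mu]_x (f i x * phi k x) - v k i * a k).
  by rewrite !mulrBr !(mulrCA _ (v k i)) cl; ring.
apply: le_trans (ler_normB _ _) _; rewrite (normrM (c k)) (normrM t%:num).
rewrite (ger0_norm (c0 k)) (ger0_norm t0).
have -> : e * (t%:num * a k) = c k * (e / 2 * l k) + t%:num * (e / 2 * a k).
  by rewrite (mulrCA (c k)) cl; field.
by apply: lerD; apply: ler_wpM2l => //; exact: near_v.
Qed.

(** Moving the cut slightly towards the constant [t] keeps its integral and
    bounds it away from 0 and 1, which leaves room to shift it by a constant. *)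
Lemma exists_interior_cut (t : {i01 R}) mu nu (I : finType)
    (f : I -> X -> R) (e : R) :
    0 < t%:num < 1 -> (forall i, bcont (f i)) -> 0 < e ->
  exists g (del : R), [/\ bcont g, 0 < del, forall x, del <= g x <= 1 - del,
    \int[mix t mu nu]_x g x = t%:num &
    forall i, `|\int[mix t mu nu]_x (f i x * g x) - t%:num * \int[mu]_x f i x|
              <= e].
Proof.
move=> /andP[]; set lam := mix t mu nu; set T := t%:num => t0 t1 cf e0.
have [M M0 fM] := bcont_bound_fin cf.
have e20 : 0 < e / 2 by rewrite divr_gt0.
have [g [cg g01 gt gf]] := exists_cut t mu nu cf e20.
pose eta := Num.min (1 / 2) (e / (4 * M)).
have eta0 : 0 < eta by rewrite lt_min !divr_gt0// mulr_gt0.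
have eta12 : eta <= 1 / 2 by rewrite ge_min lexx.
have etaM : eta * (2 * M) <= e / 2.
  have : eta <= e / (4 * M) by rewrite ge_min lexx orbT.
  rewrite ler_pdivlMr ?mulr_gt0//; lra.
exists (fun x => (1 - eta) * g x + eta * T), (eta * Num.min T (1 - T)).
have cZ a (k : X -> R) : bcont k -> bcont (fun x => a * k x).
  by move=> ck; apply: bcontM => //; exact: bcont_cst.
split.
- by apply: bcontD; [exact: cZ|exact: bcont_cst].
- by rewrite mulr_gt0// lt_min t0 subr_gt0.
- move=> x; have /andP[g0 g1] := g01 x.
  have mT : eta * Num.min T (1 - T) <= eta * T.
    by rewrite ler_pM2l// ge_min lexx.
  have mT1 : eta * Num.min T (1 - T) <= eta * (1 - T).
    by rewrite ler_pM2l// ge_min lexx orbT.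
  have eta1 : 0 <= 1 - eta by lra.
  have := mulr_ge0 eta1 g0; have := ler_wpM2l eta1 g1.
  by move=> ? ?; apply/andP; split; lra.
- rewrite intD; [|exact: cZ|exact: bcont_cst].
  by rewrite intZ// int_cst gt -/T; ring.
move=> i.
have cfg : bcont (fun x => f i x * g x) by exact: bcontM.
have -> : \int[lam]_x (f i x * ((1 - eta) * g x + eta * T)) =
    (1 - eta) * \int[lam]_x (f i x * g x) + eta * T * \int[lam]_x f i x.
  rewrite -!intZ// -intD; [|exact: cZ|exact: cZ].
  by apply: eq_Rintegral => x _; ring.
have fM' (m : borel_prob X R) : `|\int[m]_x f i x| <= M.
  by rewrite -[leRHS](int_cst m); apply: int_normr => //; exact: bcont_cst.
have -> : (1 - eta) * \int[lam]_x (f i x * g x) + eta * T * \int[lam]_x f i x -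
      T * \int[mu]_x f i x =
    (1 - eta) * (\int[lam]_x (f i x * g x) - T * \int[mu]_x f i x) +
    eta * T * (\int[lam]_x f i x - \int[mu]_x f i x) by ring.
apply: le_trans (ler_normD _ _) _; rewrite [leRHS]splitr !normrM.
apply: lerD.
  apply: le_trans (gf i); apply: ler_piMl => //.
  by rewrite ger0_norm; lra.
apply: le_trans etaM; apply: ler_pM => //; last first.
  by apply: le_trans (ler_normB _ _) _; have := fM' lam; have := fM' mu; lra.
rewrite (gtr0_norm eta0) (gtr0_norm t0).
by apply: ler_piMr; exact: ltW.
Qed.

Lemma near_int lam (I : finType) (f : I -> X -> R) (e : R) :
  (forall i, bcont (f i)) -> 0 < e ->
  \forall lam' \near lam, forall i,
    `|\int[lam]_x f i x - \int[lam' : borel_prob X R]_x f i x| < e.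
Proof.
move=> cf e0.
have near_i i : \forall lam' \near lam,
    `|\int[lam]_x f i x - \int[lam' : borel_prob X R]_x f i x| < e.
  by have /cvgrPdist_lt/(_ _ e0) := @continuous_int _ _ _ (cf i) lam.
exact: (filter_forall _ near_i).
Qed.

(** A continuous function [c] that approximately cuts [t mu] out of the mixture
    [lam] also cuts measures [lam'] close to [lam] into pieces close to [t mu]
    and [(1 - t) nu], since these conditions involve only finitely many
    integrals of continuous functions against [lam']. The first piece has mass
    close to [t]; adding a small constant [s] to [c] makes it exactly [t]. *)
Lemma mix_open (t : {i01 R}) mu nu (B O : set (borel_prob X R)) :
    0 < t%:num < 1 -> nbhs mu B -> nbhs nu O ->
  nbhs (mix t mu nu)
    [set lam | exists mu' nu', [/\ B mu', O nu' & lam = mix t mu' nu']].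
Proof.
move=> t01 /weak_nbhsP[I [f [e [cf e0 fB]]]] /weak_nbhsP[J [g [d [cg d0 gO]]]].
have /andP[t0 t1] := t01.
(* both families of test functions at once: a cut must control the two pieces *)
pose h (k : I + J) := match k with inl i => f i | inr j => g j end.
have ch k : bcont (h k) by case: k.
have [M M0 hM] := bcont_bound_fin ch.
set T := t%:num in t0 t1.
(* normalizing pieces of mass [T] and [1 - T] magnifies errors by at most
   [1 / tau] *)
pose tau := Num.min T (1 - T).
have tau0 : 0 < tau by rewrite lt_min t0 subr_gt0.
have tauT : tau <= T by rewrite ge_min lexx.
have tauT1 : tau <= 1 - T by rewrite ge_min lexx orbT.
pose eps := tau * Num.min e d.
have eps0 : 0 < eps by rewrite mulr_gt0// lt_min e0 d0.
have eps40 : 0 < eps / 4 by rewrite divr_gt0.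
set lam := mix t mu nu.
have [c [del [cc del0 cdel ct chc]]] := exists_interior_cut mu nu t01 ch eps40.
have c_hc k : bcont (fun x => h k x * c x) by exact: bcontM.
pose r := Num.min del (eps / (4 * M)).
have r0 : 0 < r by rewrite lt_min del0 divr_gt0// mulr_gt0.
have near_c := near_int lam (fun _ : unit => cc) r0.
have near_h := near_int lam ch eps40.
have near_hc := near_int lam c_hc eps40.
near=> lam'.
have n1 : `|\int[lam]_x c x - \int[lam']_x c x| < r.
  by move: tt; near: lam'.
have n2 : forall k,
    `|\int[lam]_x (h k x * c x) - \int[lam']_x (h k x * c x)| < eps / 4.
  by near: lam'.
have n3 : forall k, `|\int[lam]_x h k x - \int[lam']_x h k x| < eps / 4.
  by near: lam'.
rewrite ct -/T in n1; set s := T - _ in n1.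
have cs : bcont (fun x => c x + s) by apply: bcontD => //; exact: bcont_cst.
have cs01 x : 0 <= c x + s <= 1.
  have : `|s| <= del.
    by apply: ltW; apply: lt_le_trans n1 _; rewrite ge_min lexx.
  have /andP[? ?] := cdel x.
  by rewrite ler_norml => /andP[? ?]; apply/andP; split; lra.
have ics : \int[lam']_x (c x + s) = T.
  by rewrite intD ?int_cst /s ?subrKC//; exact: bcont_cst.
have [mu' [nu' [lam'E mu'E nu'E]]] := split_by_density t01 cs cs01 ics.
have sM k : `|s * \int[lam']_x h k x| <= eps / 4.
  have sM : `|s| * M <= eps / 4.
    have : `|s| <= eps / (4 * M).
      by apply: ltW; apply: lt_le_trans n1 _; rewrite ge_min lexx orbT.
    rewrite ler_pdivlMr ?mulr_gt0//; lra.
  rewrite normrM; apply: le_trans sM; apply: ler_wpM2l => //.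
  rewrite -[leRHS](int_cst lam'); apply: int_normr => //; exact: bcont_cst.
have close_mu k : `|T * (\int[mu']_x h k x - \int[mu]_x h k x)| < 3 * (eps / 4).
  have -> : T * (\int[mu']_x h k x - \int[mu]_x h k x) =
      (\int[lam]_x (h k x * c x) - T * \int[mu]_x h k x) -
      (\int[lam]_x (h k x * c x) - \int[lam']_x (h k x * c x)) +
      s * \int[lam']_x h k x.
    rewrite mulrBr mu'E//.
    have -> : \int[lam']_x (h k x * (c x + s)) =
        \int[lam']_x (h k x * c x) + s * \int[lam']_x h k x.
      rewrite -intZ// -intD//; last by apply: bcontM => //; exact: bcont_cst.
      by apply: eq_Rintegral => x _; ring.
    by ring.
  have := sM k; have := n2 k; have := chc k; rewrite -/lam -/T.
  rewrite !ler_norml !ltr_norml => /andP[? ?] /andP[? ?] /andP[? ?].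
  by apply/andP; split; lra.
have close_nu k : `|(1 - T) * (\int[nu']_x h k x - \int[nu]_x h k x)| < eps.
  have -> : (1 - T) * (\int[nu']_x h k x - \int[nu]_x h k x) =
      - (\int[lam]_x h k x - \int[lam']_x h k x) -
      T * (\int[mu']_x h k x - \int[mu]_x h k x).
    by rewrite lam'E /lam !int_mix// -/T; ring.
  have := n3 k; have := close_mu k; rewrite !ltr_norml => /andP[? ?] /andP[? ?].
  by apply/andP; split; lra.
have T1 : 0 < 1 - T by rewrite subr_gt0.
exists mu', nu'; split => //.
- apply: fB => i; have := close_mu (inl i).
  rewrite normrM (gtr0_norm t0) => h1.
  rewrite -(ltr_pM2l tau0); apply: le_lt_trans (ler_wpM2r _ tauT) _ => //.
  apply: lt_le_trans h1 _; apply: (@le_trans _ _ eps); first lra.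
  by rewrite ler_pM2l// ge_min lexx.
- apply: gO => j; have := close_nu (inr j).
  rewrite normrM (gtr0_norm T1) => h1.
  rewrite -(ltr_pM2l tau0); apply: le_lt_trans (ler_wpM2r _ tauT1) _ => //.
  by apply: lt_le_trans h1 _; rewrite ler_pM2l// ge_min lexx orbT.
Unshelve. all: by end_near.
Qed.

End open_mix.

(** * Second countability of the weak topology *)

Section second_countable.
Context {X : ptopologicalType} {R : realType} {J : countType} (h : J -> X -> R).
Hypothesis (ch : forall j, bcont (h j)).
Implicit Types (f g : X -> R) (mu nu lam : borel_prob X R).

Definition fmax (s : seq J) (x : X) : R := \big[Num.max/0]_(j <- s) h j x.

Lemma bcont_fmax s : bcont (fmax s).
Proof.
elim: s => [|j s ih].
  have := @bcont_cst X R 0; congr bcont; apply/funext => x.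
  by rewrite /fmax big_nil.
have := bcont_max (ch j) ih; congr bcont; apply/funext => x.
by rewrite /fmax big_cons.
Qed.

(** [f] is the supremum of 0 and of the functions [h j] below it. *)
Definition minorized f := forall x r, 0 <= r < f x ->
  exists2 j, (forall y, h j y <= f y) & r < h j x.

(** Listing the [h j] below [f], their successive maxima increase to [f], so
    monotone convergence applies. *)
Lemma int_minorized f mu r : bcont f -> (forall x, 0 <= f x) -> minorized f ->
  r < \int[mu]_x f x ->
  exists2 s, (forall x, fmax s x <= f x) & r < \int[mu]_x fmax s x.
Proof.
move=> cf f0 hf rf.
pose s k := [seq j <- pmap unpickle (iota 0 k) | `[< forall y, h j y <= f y >]].
have sP j : (forall y, h j y <= f y) -> j \in s (pickle j).+1.
  move=> jf; rewrite mem_filter; apply/andP; split; first exact/asboolP.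
  rewrite mem_pmap; apply/mapP; exists (pickle j); last by rewrite pickleK.
  by rewrite mem_iota leq0n add0n ltnSn.
have sS k l : (k <= l)%N -> {subset s k <= s l}.
  move=> kl j; rewrite !mem_filter => /andP[-> /=].
  rewrite !mem_pmap => /mapP[n nk ->]; apply/mapP; exists n => //.
  by move: nk; rewrite !mem_iota !add0n => /leq_trans; exact.
have fmax0 l x : 0 <= fmax l x by exact: bigmax_ge_id.
have fmaxf k x : fmax (s k) x <= f x.
  rewrite /fmax big_seq; apply: bigmax_le => // j.
  by rewrite mem_filter => /andP[/asboolP].
have fmaxS k l x : (k <= l)%N -> fmax (s k) x <= fmax (s l) x.
  move=> kl; rewrite {1}/fmax big_seq; apply: bigmax_le => // j js.
  by apply: le_bigmax_seq => //; exact: sS js.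
have fmax_cvg x : fmax (s k) x @[k --> \oo] --> f x.
  apply/cvgrPdist_lt => e e0.
  have [k0 fk0] : exists k0, f x - e < fmax (s k0) x.
    have [fe|fe] := ltP (f x - e) 0.
      by exists 0%N; exact: lt_le_trans (fmax0 _ _).
    have [|j jf je] := hf x (f x - e); first by rewrite fe ltrBlDr ltrDl.
    exists (pickle j).+1; apply: lt_le_trans je _.
    by apply: le_bigmax_seq => //; exact: sP.
  near=> k; rewrite ger0_norm ?subr_ge0//.
  rewrite ltrBlDr addrC -ltrBlDr; apply: lt_le_trans fk0 _.
  by apply: fmaxS; near: k; exact: nbhs_infty_ge.
apply: contrapT => nos.
have sr k : \int[mu]_x fmax (s k) x <= r.
  by rewrite leNgt; apply/negP => kr; apply: nos; exists (s k).
suff : \int[mu]_x f x <= r by rewrite leNgt rf.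
rewrite -lee_fin EFin_int//.
have mk k : measurable_fun setT (fun x : borel X => (fmax (s k) x)%:E).
  by apply/measurable_EFinP; apply: bcont_measurable; exact: bcont_fmax.
have -> : (\int[mu]_x (f x)%:E)%E =
    (\int[mu]_x limn (fun k => (fmax (s k) x)%:E))%E.
  apply: eq_integral => x _; apply/esym/cvg_lim => //.
  by apply: cvg_EFin; [exact: nearW|exact: fmax_cvg].
have mono (x : borel X) : [set: borel X] x ->
    {homo (fun k => (fmax (s k) x)%:E) : k l / (k <= l)%N >-> (k <= l)%E}.
  by move=> _ k l kl; rewrite lee_fin; exact: fmaxS.
have pos k (x : borel X) : [set: borel X] x -> (0 <= (fmax (s k) x)%:E)%E.
  by rewrite lee_fin.
rewrite (monotone_convergence mu measurableT mk pos mono).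
apply: lime_le.
  apply: ereal_nondecreasing_is_cvgn => k l kl.
  by apply: ge0_le_integral => // x _; [exact: pos|exact: mono].
by apply: nearW => k; rewrite -EFin_int ?lee_fin//; exact: bcont_fmax.
Unshelve. all: by end_near.
Qed.

(** The sets of measures for which the integral of a finite maximum of the [h j]
    exceeds a given rational form a countable subbase: they bound the integral
    of any nonnegative [f] from below, hence, after adding constants, those of
    any bounded continuous [f] and of [- f]. *)
Lemma second_countable_borel_prob :
  (forall f, bcont f -> (forall x, 0 <= f x) -> minorized f) ->
  @second_countable (borel_prob X R).
Proof.
move=> hmin.
pose S (u : seq J * rat) : set (borel_prob X R) :=
  [set mu : borel_prob X R | ratr u.2 < \int[mu]_x fmax u.1 x].
pose U (l : seq (seq J * rat)) : set (borel_prob X R) :=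
  [set mu | forall u, u \in l -> S u mu].
have oS u : open (S u).
  apply: (@open_comp _ _ (fun mu : borel_prob X R => \int[mu]_x fmax u.1 x : R)
    [set y | ratr u.2 < y]).
    by move=> mu _; apply: continuous_int; exact: bcont_fmax.
  exact: open_gt.
have oU l : open (U l).
  elim: l => [|u l ih].
    by rewrite (_ : U [::] = setT); [exact: openT|apply/seteqP; split].
  rewrite (_ : U (u :: l) = S u `&` U l); first exact: openI.
  apply/seteqP; split => [mu Umu|mu [h1 h2] v].
    split; first by apply: Umu; rewrite mem_head.
    by move=> v vl; apply: Umu; rewrite inE vl orbT.
  by rewrite inE => /predU1P[->//|/h2].
exists (range U).
  exact: card_le_trans (card_image_le _ _) (countableP _).
split=> [_ [l _ <-]//|mu A /weak_nbhsP[I [f [e [cf e0 fA]]]]].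
have lower (g : X -> R) : bcont g -> exists u, S u mu /\
    forall nu : borel_prob X R, S u nu ->
      \int[mu]_x g x - e < \int[nu]_x g x.
  move=> cg; have [M M0 gM] := bcont_bound cg.
  have cgM : bcont (fun x => g x + M) by apply: bcontD => //; exact: bcont_cst.
  have gM0 x : 0 <= g x + M.
    by have := gM x; rewrite ler_norml => /andP[]; lra.
  have igM (nu : borel_prob X R) : \int[nu]_x (g x + M) = \int[nu]_x g x + M.
    by rewrite intD ?int_cst//; exact: bcont_cst.
  have [||s sg sr] := @int_minorized _ mu (\int[mu]_x (g x + M) - e) cgM gM0.
    exact: hmin.
    by rewrite ltrBlDr ltrDl.
  have [q] := rat_in_itvoo sr; rewrite in_itv/= => /andP[q1 q2].
  exists (s, q); split => // nu /= qnu.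
  have := le_int nu (bcont_fmax s) cgM sg; rewrite igM.
  by move: q1 qnu; rewrite igM /S/=; lra.
have /choice[u uP] : forall i, exists u, S u mu /\
    forall nu : borel_prob X R, S u nu ->
      \int[mu]_x f i x - e < \int[nu]_x f i x.
  by move=> i; exact: lower.
have /choice[v vP] : forall i, exists u, S u mu /\
    forall nu : borel_prob X R, S u nu ->
      \int[nu]_x f i x < \int[mu]_x f i x + e.
  move=> i; have cN : bcont (fun x => -1 * f i x).
    by apply: bcontM => //; exact: bcont_cst.
  have [w [wmu wP]] := lower _ cN; exists w; split => // nu /wP.
  by rewrite !intZ//; lra.
exists (U (map u (enum I) ++ map v (enum I))).
  split; first by exists (map u (enum I) ++ map v (enum I)).
  move=> w; rewrite mem_cat => /orP[] /mapP[i _ ->]; first exact: (uP i).1.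
  exact: (vP i).1.
move=> nu Unu; apply: fA => i.
have : S (u i) nu by apply: Unu; rewrite mem_cat map_f ?mem_enum.
have : S (v i) nu.
  by apply: Unu; rewrite mem_cat [X in _ || X]map_f ?orbT ?mem_enum.
move=> /(vP i).2 v1 /(uP i).2 u1.
by rewrite ltr_norml; apply/andP; split; lra.
Qed.

End second_countable.

Section bumps.
Context {R : realType} {X : ptopologicalType}.

Lemma mdist_continuous (M : metricType R) (a : M) :
  continuous (fun z : M => mdist z a).
Proof.
move=> z; apply/cvgrPdist_lt => e e0.
have : \forall t \near z, mdist z t < e.
  by apply: (@metricType_numDomainType.cvgr_dist_lt _ _ _ _ _ id) => //;
    exact: cvg_id.
apply: filterS => t zt; apply: le_lt_trans zt.
rewrite ler_norml; have := metric_triangle t z a; have := metric_triangle z t a.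
by rewrite (metric_sym t z) => ? ?; apply/andP; split; lra.
Qed.

(** Tents of rational height, with centers in a countable dense set and radii
    [1 / n], for the metric transported from a homeomorphic metric space. If
    [r < q < f x], a narrow enough tent of height [q] centered near [x] lies
    below [f] and still exceeds [r] at [x]. *)
Lemma exists_bumps : polish R X ->
  exists (J : countType) (h : J -> X -> R), (forall j, bcont (h j)) /\
    forall f, bcont f -> (forall x, 0 <= f x) -> minorized h f.
Proof.
move=> [[D /pfcard_geP[D0|[d]] denseD] [M [phi [psi [phiK psiK cphi cpsi _]]]]].
  have [] := denseD setT; [by exists point|exact: openT|].
  by move=> x; rewrite D0 => -[].
pose dist (a : nat) (x : X) := mdist (phi x) (phi (d a)).
pose bump (j : nat * nat * rat) (x : X) : R :=
  `|ratr j.2| * Num.max 0 (1 - j.1.2%:R * dist j.1.1 x).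
have cdist a : continuous (dist a).
  move=> x; apply: (@continuous_comp _ _ _ phi (fun z => mdist z (phi (d a)))).
    exact: cphi.
  exact: mdist_continuous.
have dist0 a x : 0 <= dist a x by exact: mdist_ge0.
exists (nat * nat * rat)%type, bump; split.
  move=> [[a n] q]; apply: bcontM; first exact: bcont_cst.
  apply: (@bcont_of_bound _ _ _ 1) => x.
    apply: (@continuous_max _ _ (fun=> 0) (fun x => 1 - n%:R * dist a x)).
      exact: cvg_cst.
    apply: cvgB; first exact: cvg_cst.
    by apply: cvgM; [exact: cvg_cst|exact: cdist].
  rewrite ger0_norm ?le_max ?lexx//= ge_max ler01/= gerBl.
  by rewrite mulr_ge0.
move=> f cf f0 x r /andP[r0 rf].
have [q] := rat_in_itvoo rf; rewrite in_itv/= => /andP[rq qf].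
have q0 : 0 < ratr q :> R by exact: le_lt_trans rq.
have /metricType_numDomainType.nbhs_mdistP[e /= e0 eq_f] :
    \forall z \near phi x, ratr q < f (psi z).
  apply: (cvgr_gt (f (psi (phi x)))); last by rewrite phiK.
  by apply: (@continuous_comp _ _ _ psi f); [exact: cpsi|exact: cf.1].
(* with a radius below [e / 2], all points of a tent whose support contains [x]
   are within [e] of [x] *)
pose n := (Num.truncn (2 / e)).+1.
have n0 : 0 < n%:R :> R by [].
have ne : n%:R^-1 < e / 2.
  by rewrite -[e / 2]invrK ltf_pV2 ?posrE ?invr_gt0 ?divr_gt0//
    invf_div truncnS_gt.
pose del := Num.min (n%:R^-1) ((1 - r / ratr q) / n%:R).
have rq1 : r / ratr q < 1 by rewrite ltr_pdivrMr// mul1r.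
have del0 : 0 < del by rewrite lt_min invr_gt0 n0 divr_gt0// subr_gt0.
have [a xa] : exists a, mdist (phi (d a)) (phi x) < del.
  have [||y [/= xy /(@surj _ _ _ _ d)[a _ ay]]] :=
    denseD [set y | mdist (phi y) (phi x) < del].
  - by exists x; rewrite /= mdistxx.
  - apply: (@open_comp _ _ (fun y => mdist (phi y) (phi x)) [set z | z < del]).
      move=> y _.
      apply: (@continuous_comp _ _ _ phi (fun z => mdist z (phi x))).
        exact: cphi.
      exact: mdist_continuous.
    exact: open_lt.
  - by exists a; rewrite ay.
have dax : dist a x = mdist (phi (d a)) (phi x) by rewrite /dist metric_sym.
exists (a, n, q) => [z|]; rewrite /bump/= (gtr0_norm q0).
  have [far|close] := leP 1 (n%:R * dist a z).
    by rewrite (max_idPl _) ?mulr0// subr_le0.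
  have qz : ratr q < f z.
    rewrite -(phiK z); apply: eq_f => /=.
    have az : dist a z < e / 2.
      by apply: lt_trans ne; rewrite -[n%:R^-1]mulr1 ltr_pdivlMl.
    have ax : dist a x < e / 2.
      rewrite dax; apply: lt_trans ne; apply: lt_le_trans xa _.
      by rewrite ge_min lexx.
    apply: le_lt_trans (metric_triangle _ (phi (d a)) _) _.
    rewrite [ltRHS]splitr; apply: ltrD => //.
    by rewrite metric_sym.
  apply: le_trans (ltW qz); rewrite ler_piMr ?(ltW q0)// ge_max ler01/= gerBl.
  by rewrite mulr_ge0.
apply: (@lt_le_trans _ _ (ratr q * (1 - n%:R * dist a x))); last first.
  by rewrite ler_pM2l// le_max lexx orbT.
have : dist a x < (1 - r / ratr q) / n%:R.
  by rewrite dax; apply: lt_le_trans xa _; rewrite ge_min lexx orbT.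
rewrite ltr_pdivlMr// mulrC => h.
have : r / ratr q < 1 - n%:R * dist a x by lra.
by rewrite ltr_pdivrMr// mulrC.
Qed.

End bumps.

(** * The dichotomy *)

Theorem theoremB (R : realType) (X : ptopologicalType) (polX : polish R X)
    (F : set (borel_prob X R)) (faceF : face F) (bpF : baire_property F) :
  meager F \/ comeager F.
Proof.
have [J [h [ch hmin]]] := exists_bumps polX.
have sc := second_countable_borel_prob ch hmin.
have [U oU mFU] := bpF.
have [mU|nmU] := pselect (meager U); [left|right].
  apply: meager_sub (meagerU mU mFU) => mu Fmu.
  have [Umu|nUmu] := pselect (U mu); [by left|by right; left].
have [N nN UFN] : meager (U `\` F) by apply: meager_sub mFU => mu ?; right.
have k0 k : 0 <= k.+2%:R^-1 :> R by rewrite invr_ge0.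
have k1 k : k.+2%:R^-1 <= 1 :> R by rewrite invf_le1// ler1n.
pose t k : {i01 R} := Itv01 (k0 k) (k1 k).
have t01 k : 0 < (t k)%:num < 1.
  by rewrite /= invr_gt0 ltr0n/= invf_lt1// ltr1n.
have t0 : (t k)%:num @[k --> \oo] --> (0 : R).
  by have := @cvg_harmonic R; rewrite -cvg_shiftS.
have mbad (u : nat * nat) :
    meager [set nu | ~ nowhere_dense [set mu | N u.1 (mix (t u.2) mu nu)]].
  apply: generic_section => //.
  - move=> mu nu.
    apply: (@mix_cvg X R _ (nbhs nu) _ (fun=> t u.2) (fun=> mu) id);
      [exact: cvg_cst|exact: cvg_cst|exact: cvg_id].
  - move=> nu mu.
    apply: (@mix_cvg X R _ (nbhs mu) _ (fun=> t u.2) id (fun=> nu));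
      [exact: cvg_cst|exact: cvg_id|exact: cvg_cst].
  - by move=> mu nu B O; exact: mix_open.
have [nu Unu good] : exists2 nu, U nu &
    forall n k, nowhere_dense [set mu | N n (mix (t k) mu nu)].
  apply: contrapT => nogood; apply: nmU.
  apply: meager_sub (meager_bigcup_meager mbad) => nu Unu.
  apply: contrapT => nbad; apply: nogood; exists nu => // n k.
  by apply: contrapT => bad; apply: nbad; exists (n, k).
apply: (@meager_sub _ _ (\bigcup_(u : nat * nat)
  [set mu | N u.1 (mix (t u.2) mu nu)])); last first.
  by apply: meager_bigcup => u; exact: good.
move=> mu nFmu.
have mix_nu : mix (t k) mu nu @[k --> \oo] --> nu.
  have nuE : mix 0%:i01 mu nu = nu := conv0 mu nu.
  rewrite -[X in _ --> X]nuE.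
  apply: (@mix_cvg X R _ \oo _ t (fun=> mu) (fun=> nu)) => //.
    exact: cvg_cst.
  exact: cvg_cst.
have [k _ /(_ k (leqnn k)) Uk] := mix_nu _ (open_nbhs_nbhs (conj oU Unu)).
have [|n _ Nn] := UFN (mix (t k) mu nu); last by exists (n, k).
by split=> // Fmix; apply: nFmu; have [] := faceF.2 mu nu (t k) (t01 k) Fmix.
Qed.
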